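(* For $n\ge 1$, let $f_0(n)$ be the number of binary words (over $\{0,1\}$) of length $n-1$ in which $0$ and $1$ appear only as subwords of the form $1i$, where $i$ is a run of zeros of length at least $1$. Then: (1) $f_0(1)=1$, $f_0(2)=0$, and $f_0(n+2)=f_0(n+1)+f_0(n)$ for $n>1$. (2) For $n>1$, we have $f_0(n)=F_{n-2}$.
   Context: The condition on words means that the word is a (possibly empty) concatenation of blocks of the form $10^j$ with $j\ge 1$, i.e. a $1$ followed by $j\ge 1$ zeros. $F_n$ denotes the Fibonacci numbers with $F_0=0$, $F_1=1$, $F_{n+2}=F_{n+1}+F_n$. *)

(* Defs.v *)
From mathcomp Require Import all_boot boolp.

Set Implicit Arguments.
Unset Strict Implicit.
Unset Printing Implicit Defensive.

(* Binary words are [seq bool], with the letter 1 encoded by [true] and the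
   letter 0 by [false]. *)
Definition block (j : nat) : seq bool := true :: nseq j false.

(* The sequence [js] may be empty, so the empty word is admissible. *)
Definition admissible (w : seq bool) : Prop :=
  exists2 js : seq nat,
    (forall j, j \in js -> 1 <= j) & w = flatten [seq block j | j <- js].

(* Only meaningful for [n >= 1], where [n.-1] is the true predecessor. *)
Definition f0 (n : nat) : nat :=
  #|[set w : (n.-1).-tuple bool | `[< admissible w >]]|.

Fixpoint fib (n : nat) : nat :=
  match n with
  | 0 => 0
  | 1 => 1
  | (m.+1 as p).+1 => fib p + fib m
  end.

(* Main.v *)
Require Import Defs.
From mathcomp Require Import all_boot boolp.

(** Every nonempty admissible word starts with 10, so it is 10w for some w.
    Its first block is either exactly 10, and then w is itself admissible, or
    longer, and then removing one zero from it leaves the admissible word 1w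
    ([admissible_10]).  The two cases exclude each other, as a nonempty w
    starts with 1 in the first and with 0 in the second.  Hence the admissible
    words of length m + 2 correspond bijectively to the disjoint union of those
    of length m and those of length m + 1 ([f0_rec]).  This is the Fibonacci
    recurrence, and the empty word (admissible) and the words of length 1
    (never admissible) give its initial values. *)

Lemma admissible_nil : admissible [::].
Proof. by exists [::]. Qed.

Lemma admissible_shape w :
  admissible w -> w = [::] \/ exists w', w = [:: true, false & w'].
Proof.
case=> [[|j js]] js_gt0 ->; first by left.
right; have: 0 < j by apply: js_gt0; rewrite mem_head.
by case: j {js_gt0} => // j _; exists (nseq j false ++ flatten (map block js)).
Qed.

(** The alternatives are read off the length of the first block: 1 leaves the
    remaining blocks, and j + 2 shortens to j + 1, which is still at least 1. *)
Lemma admissible_10 w :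
  admissible [:: true, false & w] <-> admissible w \/ admissible (true :: w).
Proof.
split=> [[[|j js] //= js_gt0]|[[js js_gt0 ->]|[[|j js] //= js_gt0 [->]]]].
- have js'_gt0 i : i \in js -> 0 < i.
    by move=> i_js; apply: js_gt0; rewrite inE i_js orbT.
  case: j js_gt0 => [/(_ 0 (mem_head _ _)) //|[|j] _] /= [->].
    by left; exists js.
  right; exists (j.+1 :: js) => // i.
  by rewrite inE => /orP[/eqP ->|/js'_gt0].
- by exists (1 :: js) => // i; rewrite inE => /orP[/eqP ->|/js_gt0].
- exists (j.+1 :: js) => // i; rewrite inE => /orP[/eqP -> //|i_js].
  by apply: js_gt0; rewrite inE i_js orbT.
Qed.

Lemma f0_1 : f0 1 = 1.
Proof.
rewrite /f0 (_ : [set w | _] = [set: 0.-tuple bool]).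
  by rewrite cardsT card_tuple.
by apply/setP=> w; rewrite !inE tuple0; apply/asboolP/admissible_nil.
Qed.

Lemma f0_2 : f0 2 = 0.
Proof.
apply: eq_card0 => w; rewrite inE; apply/asboolP=> /admissible_shape.
by case=> [|[w']] /(congr1 size); rewrite size_tuple.
Qed.

(** The words 10w with w admissible are the image of the admissible words of
    length m; those with 1w admissible are the image of the admissible words of
    length m + 1 under insertion of a zero after the first letter, which is
    injective there because the first letter of each is 1. *)
Lemma f0_rec m : f0 m.+3 = f0 m.+2 + f0 m.+1.
Proof.
rewrite /f0 /=.
set A2 := [set w : m.+2.-tuple bool | _].
set A1 := [set w : m.+1.-tuple bool | _]; set A0 := [set w | _].
pose new (w : m.-tuple bool) := [tuple of [:: true, false & w]].
pose grow (w : m.+1.-tuple bool) := new [tuple of behead w].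
have A1_1 w : w \in A1 -> tval w = true :: behead w.
  rewrite inE => /asboolP/admissible_shape[w0|[w' -> //]].
  by have := size_tuple w; rewrite w0.
have -> : A2 = grow @: A1 :|: new @: A0.
  apply/setP=> w; rewrite in_setU [in LHS]inE; apply/asboolP/orP=> [w_adm|].
    case: (admissible_shape _ w_adm) => [w0|[w' w_def]].
      by have := size_tuple w; rewrite w0.
    have w'm : size w' == m by have := size_tuple w; rewrite w_def => -[->].
    move: w_adm; rewrite w_def => /admissible_10[w'_adm|w'_adm].
      right; apply/imsetP; exists (Tuple w'm); last exact: val_inj.
      by rewrite inE; apply/asboolP.
    left; apply/imsetP; exists [tuple of true :: Tuple w'm].
      by rewrite inE; apply/asboolP.
    exact: val_inj.
  case=> /imsetP[v v_adm ->]; apply/admissible_10; [right|left].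
    by rewrite /= -A1_1 //; move: v_adm; rewrite inE => /asboolP.
  by move: v_adm; rewrite inE => /asboolP.
have disj : [disjoint grow @: A1 & new @: A0].
  rewrite -setI_eq0; apply/eqP/setP=> w; rewrite !inE; apply/negP.
  case/andP=> /imsetP[u u_adm ->] /imsetP[v v_adm] /(congr1 val)[uv].
  have := A1_1 u u_adm; move: u_adm v_adm; rewrite !inE uv.
  (* u = 1v is admissible, so v starts with 0, whereas v is itself admissible. *)
  move=> /asboolP/admissible_shape[u0|[u' u_def]] /asboolP; first by rewrite u0.
  by rewrite u_def => /admissible_shape[->|[v' ->]].
rewrite cardsU disjoint_setI0 // cards0 subn0 !card_in_imset //.
  by move=> u v _ _ /(congr1 val)[/val_inj].
move=> u v /A1_1 u1 /A1_1 v1 /(congr1 val)[uv].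
by apply: val_inj; rewrite /= u1 v1 uv.
Qed.

Lemma f0_fib m : f0 m.+2 = fib m.
Proof.
(* The recurrence has order two, so consecutive values are carried together. *)
suff [] : f0 m.+2 = fib m /\ f0 m.+3 = fib m.+1 by [].
elim: m => [|m [IH0 IH1]]; first by rewrite f0_rec f0_2 f0_1.
by split=> //; rewrite f0_rec IH1 IH0.
Qed.

Theorem proposition11 :
  [/\ f0 1 = 1, f0 2 = 0
    & forall n : nat, 1 < n -> f0 n.+2 = f0 n.+1 + f0 n]
  /\ (forall n : nat, 1 < n -> f0 n = fib (n - 2)).
Proof.
split; first split; [exact: f0_1 | exact: f0_2 | by case=> // n _; exact: f0_rec |].
by case=> [|[|n]] // _; rewrite f0_fib !subSS subn0.
Qed.
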